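(* Let $\mathbb{B}=\{0,1\}$ be the Boolean semiring. The generalised regularity properties of the monoids $M_n(\mathbb{B})$, $UT_n(\mathbb{B})$ and $U_n(\mathbb{B})$ are as follows. (1) $M_1(\mathbb{B})$ is regular (and a band); $M_2(\mathbb{B})$ is regular; $M_3(\mathbb{B})$ is Fountain but not abundant; and $M_n(\mathbb{B})$ is not Fountain for all $n\geq 4$. (2) $UT_1(\mathbb{B})$ is regular (and a band); $UT_2(\mathbb{B})$ is abundant but not regular; $UT_3(\mathbb{B})$ is Fountain but not abundant; and $UT_n(\mathbb{B})$ is not Fountain for all $n\geq 4$. (3) $U_1(\mathbb{B})$ is regular (and a group); $U_2(\mathbb{B})$ is regular (and a band); and $U_n(\mathbb{B})$ is Fountain but not abundant for all $n\geq 3$.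
   Context: The Boolean semiring $\mathbb{B}=\{0,1\}$ has the usual multiplication and idempotent addition $1+1=1$. $M_n(\mathbb{B})$ is the monoid of all $n\times n$ matrices over $\mathbb{B}$ under matrix multiplication; $UT_n(\mathbb{B})$ is the submonoid of upper triangular matrices; $U_n(\mathbb{B})$ is the submonoid of upper triangular matrices with all diagonal entries equal to $1$. For a semigroup $T$ let $T^1$ be $T$ with an identity adjoined if necessary. $T$ is a band if every element is idempotent. $T$ is regular if for each $a\in T$ there is $x\in T$ with $axa=a$. Define $a\,\mathcal{R}^*\,b$ iff for all $x,y\in T^1$: $xa=ya\Leftrightarrow xb=yb$; $a\,\mathcal{L}^*\,b$ iff for all $x,y\in T^1$: $ax=ay\Leftrightarrow bx=by$; $a\,\widetilde{\mathcal{R}}\,b$ iff for all idempotents $e\in T$: $ea=a\Leftrightarrow eb=b$; $a\,\widetilde{\mathcal{L}}\,b$ iff for all idempotents $e\in T$: $ae=a\Leftrightarrow be=b$. $T$ is abundant if every $\mathcal{R}^*$-class and every $\mathcal{L}^*$-class contains an idempotent, and Fountain if every $\widetilde{\mathcal{R}}$-class and every $\widetilde{\mathcal{L}}$-class contains an idempotent. (Regular implies abundant, which implies Fountain.) *)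

(* Defs.v *)
From HB Require Import structures.
From mathcomp Require Import all_boot all_order all_algebra all_fingroup.

Set Implicit Arguments.
Unset Strict Implicit.
Unset Printing Implicit Defensive.

Import GRing.Theory.

(* In MathComp, [bool] is the field with two elements (its addition is xor), so
   the Boolean semiring needs a carrier of its own. *)
Variant boolB : Set := B0 | B1.

Definition bool_of_boolB (x : boolB) : bool := if x is B1 then true else false.
Definition boolB_of_bool (b : bool) : boolB := if b then B1 else B0.

Lemma bool_of_boolBK : cancel bool_of_boolB boolB_of_bool.
Proof. by case. Qed.

HB.instance Definition _ := Finite.copy boolB (can_type bool_of_boolBK).

Definition addB (x y : boolB) : boolB := if x is B1 then B1 else y.
Definition mulB (x y : boolB) : boolB := if x is B1 then y else B0.

Lemma addBA : associative addB. Proof. by do 3!case. Qed.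
Lemma addBC : commutative addB. Proof. by do 2!case. Qed.
Lemma add0B : left_id B0 addB. Proof. by case. Qed.
Lemma mulBA : associative mulB. Proof. by do 3!case. Qed.
Lemma mulBC : commutative mulB. Proof. by do 2!case. Qed.
Lemma mul1B : left_id B1 mulB. Proof. by case. Qed.
Lemma mulBDl : left_distributive mulB addB. Proof. by do 3!case. Qed.
Lemma mul0B : left_zero B0 mulB. Proof. by case. Qed.
Lemma B1_neq0 : B1 != B0. Proof. by []. Qed.

HB.instance Definition _ := GRing.isNmodule.Build boolB addBA addBC add0B.
HB.instance Definition _ := GRing.Nmodule_isComNzSemiRing.Build boolB
  mulBA mulBC mul1B mulBDl mul0B B1_neq0.

Section Semigroups.
Local Open Scope group_scope.
Variable T : semigroupType.
Implicit Types a b e : T.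

Definition idem e : Prop := e * e = e.

Definition band : Prop := forall a, idem a.

Definition regular : Prop := forall a, exists x : T, a * x * a = a.

Definition has_identity : Prop := exists e, forall a, e * a = a /\ a * e = a.

(* The elements of T^1 are those x : option T that satisfy [in_T1]: [None] is the
   adjoined identity, present only if T has no identity of its own. *)
Definition in_T1 (x : option T) : Prop :=
  if x is None then ~ has_identity else True.
Definition T1_mull (x : option T) a : T := if x is Some u then u * a else a.
Definition T1_mulr a (x : option T) : T := if x is Some u then a * u else a.

Definition Rstar a b : Prop := forall x y : option T, in_T1 x -> in_T1 y ->
  (T1_mull x a = T1_mull y a <-> T1_mull x b = T1_mull y b).

Definition Lstar a b : Prop := forall x y : option T, in_T1 x -> in_T1 y ->
  (T1_mulr a x = T1_mulr a y <-> T1_mulr b x = T1_mulr b y).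

Definition Rtilde a b : Prop := forall e, idem e -> (e * a = a <-> e * b = b).

Definition Ltilde a b : Prop := forall e, idem e -> (a * e = a <-> b * e = b).

Definition abundant : Prop :=
  (forall a, exists e, idem e /\ Rstar a e) /\
  (forall a, exists e, idem e /\ Lstar a e).

Definition Fountain : Prop :=
  (forall a, exists e, idem e /\ Rtilde a e) /\
  (forall a, exists e, idem e /\ Ltilde a e).

End Semigroups.

Definition is_group (T : monoidType) : Prop :=
  forall a : T, exists b : T, (b * a = 1 /\ a * b = 1)%g.

(* An alias, because MathComp makes matrices over a finite ring an additive
   [finGroupType]; the monoid law on the alias is the matrix product. *)
Definition boolM (n : nat) : Type := 'M[boolB]_n.

HB.instance Definition _ n := Finite.copy (boolM n) 'M[boolB]_n.
HB.instance Definition _ n := isMonoid.Build (boolM n)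
  (@mulmxA boolB n n n n) (@mul1mx boolB n n) (@mulmx1 boolB n n).

Lemma boolM_mulE n (A B : boolM n) : (A * B)%g = (A *m B)%R.
Proof. by []. Qed.

Lemma boolM_oneE n : 1%g = 1%:M%R :> boolM n.
Proof. by []. Qed.

Section Submonoids.
Variable n : nat.

(* [is_trig_mx] of the library is lower triangularity. *)
Definition upper_trig : pred (boolM n) :=
  fun A => [forall i : 'I_n, forall j : 'I_n, (j < i)%N ==> (A i j == 0%R)].

Definition upper_unitrig : pred (boolM n) :=
  fun A => upper_trig A && [forall i : 'I_n, A i i == 1%R].

Lemma upper_trigP (A : boolM n) :
  reflect (forall i j : 'I_n, (j < i)%N -> A i j = 0%R) (upper_trig A).
Proof.
apply: (iffP forallP) => [uA i j ltji | uA i].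
  by move/forallP/(_ j)/implyP/(_ ltji)/eqP: (uA i).
by apply/forallP=> j; apply/implyP=> /uA ->.
Qed.

Lemma upper_trig_closed : monoid_closed upper_trig.
Proof.
split=> [|A B /upper_trigP uA /upper_trigP uB]; apply/upper_trigP=> i j ltji.
  by rewrite mxE -val_eqE /= gtn_eqF.
rewrite mxE big1 // => k _; case: (ltnP k i) => [/uA -> | leik].
  by rewrite mul0r.
by rewrite (uB k) ?mulr0 // (leq_trans ltji).
Qed.

Lemma upper_unitrig_closed : monoid_closed upper_unitrig.
Proof.
have [u1 uM] := upper_trig_closed.
split=> [|A B /andP[uA /forallP dA] /andP[uB /forallP dB]].
  by apply/andP; split=> //; apply/forallP=> i; rewrite mxE eqxx.
apply/andP; split; first exact: uM.
apply/forallP=> i; rewrite mxE (bigD1 i) //= (eqP (dA i)) (eqP (dB i)) mulr1.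
by case: (\sum_(_ < n | _) _)%R.
Qed.

Record boolUT : Type := BoolUT { boolUT_val :> boolM n; _ : upper_trig boolUT_val }.
HB.instance Definition _ := [isSub for boolUT_val].
HB.instance Definition _ := [Finite of boolUT by <:].
HB.instance Definition _ :=
  SubChoice_isSubMonoid.Build (boolM n) upper_trig boolUT upper_trig_closed.

Record boolU : Type := BoolU { boolU_val :> boolM n; _ : upper_unitrig boolU_val }.
HB.instance Definition _ := [isSub for boolU_val].
HB.instance Definition _ := [Finite of boolU by <:].
HB.instance Definition _ :=
  SubChoice_isSubMonoid.Build (boolM n) upper_unitrig boolU upper_unitrig_closed.

End Submonoids.

(* Main.v *)
Require Import Defs.
From mathcomp Require Import all_boot all_order all_algebra all_fingroup.

Set Implicit Arguments.
Unset Strict Implicit.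
Unset Printing Implicit Defensive.

Import GRing.Theory.

(** A Boolean matrix is a relation on its indices: row i of X A is the union of
the rows k of A with X_ik = 1.  Hence f A = A says that each row of A is the
union of the rows of A that f selects for it, and the class of A under
R-tilde contains an idempotent exactly when, among the idempotents f with
f A = A, some e satisfies f e = e for all the others: a least left fixer of A.
Transposition exchanges the left and the right halves of every argument, and
reverses the preorder that bounds the supports of the matrices.

Existence of least fixers.  Let p be a preorder on the indices, and consider the
matrices with support in p (p is total for all matrices, and is the order of
the indices for upper triangular ones).  Call j below i when p i j and
row j of A lies in row i.  The relation below is a preorder, and a matrix with
support in p that fixes A selects for row i only rows below i.
- For unitriangular A the matrix of below is itself the least fixer, for every
  n (left_fixer_unit).
- In general one keeps only the columns j of that matrix whose row in A is
  irreducible, that is, not covered by the rows strictly below it.  This is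
  still an idempotent fixing A, and it is least when n <= 3 and p is total
  (left_fixer_small): for f e = e to fail, a row would have to be a union of
  rows none of which is above a given irreducible row below it, and three
  indices do not leave enough room for that.

Failures.  Both come from the rows {1,2}, {2,3}, {3}, whose span is the
pentagon lattice: {1,2} and {2,3} have the same union as {1,2} and {3}, although
{3} lies strictly inside {2,3}.
- With these rows as A and n >= 3, adding row 3 to row 1 or adding row 2 to
  row 1 has the same effect on A, but not on a matrix e with e A = A, so the
  class of A under R-star has no idempotent (fixer_separates_rows).
- For n >= 4, put on top of them a row equal to that common union.  Either of
  the two ways of writing the new row gives an upper triangular idempotent
  fixing the resulting matrix, and no e that fixes this matrix satisfies f e = e
  for both of these idempotents f (no_common_fixer).

What is left concerns n <= 2, where every matrix of M_2 is idempotent up to a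
swap of its columns, and where the matrix unit E_12 is the only upper triangular
2 x 2 matrix that is not idempotent. *)

(** * Boolean matrices as relations *)

Definition supp n (A : boolM n) : rel 'I_n := fun i j => A i j == B1.

Definition mx_rel n (r : rel 'I_n) : boolM n :=
  (\matrix_(i, j) boolB_of_bool (r i j))%R.

Section Support.
Variable n : nat.
Implicit Types A B : boolM n.

Lemma suppP A B : supp A =2 supp B -> A = B.
Proof.
move=> eqAB; apply/matrixP=> i j.
by have:= eqAB i j; rewrite /supp; case: (A i j); case: (B i j).
Qed.

Lemma supp_mx_rel (r : rel 'I_n) : supp (mx_rel r) =2 r.
Proof. by move=> i j; rewrite /supp mxE; case: (r i j). Qed.

Lemma supp_one : supp (1%g : boolM n) =2 (fun i j => i == j).
Proof. by move=> i j; rewrite /supp boolM_oneE mxE; case: (i == j). Qed.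

Lemma supp_add A B i j : supp (A + B)%R i j = supp A i j || supp B i j.
Proof. by rewrite /supp mxE; case: (A i j); case: (B i j). Qed.

Lemma supp_tr A i j : supp (A^T)%R i j = supp A j i.
Proof. by rewrite /supp mxE. Qed.

Lemma supp_mulP A B i j :
  reflect (exists2 k, supp A i k & supp B k j) (supp (A * B)%g i j).
Proof.
rewrite /supp boolM_mulE mxE; apply: (iffP idP) => [|[k /eqP Aik /eqP Bkj]].
  have [/existsP[k /andP[Aik Bkj]] _ | ] :=
    boolP [exists k, supp A i k && supp B k j]; first by exists k.
  rewrite negb_exists => /forallP noK; rewrite big1 // => k _.
  by have:= noK k; rewrite /supp; case: (A i k) (B k j) => -[].
by rewrite (bigD1 k) //= Aik Bkj.
Qed.

Lemma mul_supp A B i k j : supp A i k -> supp B k j -> supp (A * B)%g i j.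
Proof. by move=> Aik Bkj; apply/supp_mulP; exists k. Qed.

Lemma upper_trig_supp A :
  upper_trig A <-> subrel (supp A) (fun i j => i <= j).
Proof.
split=> [/upper_trigP uA i j | uA].
  by rewrite /supp; apply: contraTT; rewrite -ltnNge => /uA->.
apply/upper_trigP=> i j; rewrite ltnNge => nle.
by case Aij: (A i j) => //; case/negP: nle; apply: uA; apply/eqP.
Qed.

Lemma upper_unitrig_supp A :
  upper_unitrig A <-> subrel (supp A) (fun i j => i <= j) /\ reflexive (supp A).
Proof.
rewrite /upper_unitrig; split=> [/andP[/upper_trig_supp uA /forallP dA] | ].
  by split.
by case=> /upper_trig_supp uA dA; apply/andP; split=> //; apply/forallP.
Qed.

End Support.

(** * Transfer between the monoids and their matrices *)

Section Represented.
Local Open Scope group_scope.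
Variables (n : nat) (S : boolM n -> Prop) (T : monoidType).

(** One interface for the three families: T is a copy of the submonoid of all
matrices that satisfy S. *)
Definition represents (v : T -> boolM n) : Prop :=
  [/\ {morph v : x y / x * y}, injective v, forall t, S (v t)
    & forall A, S A -> exists t, v t = A].

Variable v : T -> boolM n.
Hypothesis repT : represents v.

Definition left_fixer (A e : boolM n) : Prop :=
  [/\ S e, e * e = e, e * A = A & forall f, S f -> f * A = A -> f * e = e].

Definition right_fixer (A e : boolM n) : Prop :=
  [/\ S e, e * e = e, A * e = A & forall f, S f -> A * f = A -> e * f = e].

(** If e a = a and f e = e then f a = f e a = a, so one direction of the
equivalence that defines R-tilde is automatic; the other is the minimality of
the fixer. *)
Lemma Fountain_fixers :
    (forall A, S A -> exists e, left_fixer A e) ->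
    (forall A, S A -> exists e, right_fixer A e) ->
  Fountain T.
Proof.
case: repT => vM v_inj v_in v_onto fixL fixR; split=> a.
  have [_ [/v_onto[e <-] ee ea min_e]] := fixL _ (v_in a).
  rewrite -!vM in ee ea; move/v_inj in ee; move/v_inj in ea.
  exists e; split=> // f _; split=> [fa | fe]; last by rewrite -ea mulgA fe.
  by apply: v_inj; rewrite vM min_e -?vM ?fa.
have [_ [/v_onto[e <-] ee ea min_e]] := fixR _ (v_in a).
rewrite -!vM in ee ea; move/v_inj in ee; move/v_inj in ea.
exists e; split=> // f _; split=> [fa | fe]; last by rewrite -ea -mulgA fe.
by apply: v_inj; rewrite vM min_e -?vM ?fa.
Qed.

(** An idempotent e with e R-tilde a inherits from a the idempotents that fix it
on the left, and fixes a because it fixes itself. *)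
Lemma not_Fountain_repr A f g :
    [/\ S A, S f & S g] -> [/\ f * f = f, g * g = g, f * A = A & g * A = A] ->
    (forall e, f * e = e -> g * e = e -> e * A <> A) ->
  ~ Fountain T.
Proof.
case: repT => vM v_inj _ v_onto [/v_onto[a <-] /v_onto[b <-] /v_onto[c <-]].
rewrite -!vM => -[/v_inj bb /v_inj cc /v_inj ba /v_inj ca] no_e [Fl _].
have [e [ee Rae]] := Fl a.
have /(Rae _ bb) be := ba; have /(Rae _ cc) ce := ca.
by apply: (no_e (v e)); rewrite -vM ?be ?ce //; congr v; apply/(Rae _ ee).
Qed.

(** An idempotent e with e R-star a fixes a, since e e = 1 e gives e a = 1 a. *)
Lemma not_abundant_repr A x y :
    [/\ S A, S x & S y] -> x * A = y * A ->
    (forall e, e * A = A -> x * e <> y * e) ->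
  ~ abundant T.
Proof.
case: repT => vM v_inj _ v_onto [/v_onto[a <-] /v_onto[b <-] /v_onto[c <-]].
rewrite -!vM => /v_inj bc no_e [ab _]; have [e [ee Rae]] := ab a.
have ea: e * a = a.
  by have [_] := Rae (Some e) (Some 1) I I; rewrite /= !mul1g; apply.
have [/(_ bc) be _] := Rae (Some b) (Some c) I I.
by apply: (no_e (v e)); rewrite -!vM ?ea // [b * e]be.
Qed.

End Represented.

Lemma left_fixer_tr n (S S' : boolM n -> Prop) (A e : boolM n) :
    (forall B, S' B <-> S (B^T)%R) ->
  left_fixer S' (A^T)%R e -> right_fixer S A (e^T)%R.
Proof.
move=> SS' [/SS' Se ee eA min_e]; split=> //.
- by rewrite !boolM_mulE -trmx_mul -boolM_mulE ee.
- by apply: trmx_inj; rewrite !boolM_mulE trmx_mul trmxK.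
move=> f Sf Af; apply: trmx_inj; rewrite boolM_mulE trmx_mul trmxK.
apply: min_e; first by apply/SS'; rewrite trmxK.
by rewrite boolM_mulE -trmx_mul -boolM_mulE Af.
Qed.

(** * Least fixers *)

Section Rows.
Variables (n : nat) (p : rel 'I_n).
Hypotheses (p_refl : reflexive p) (p_tr : transitive p).
Variable A : boolM n.

Definition below j i := p i j && [forall l, supp A j l ==> supp A i l].

Lemma belowP j i :
  reflect (p i j /\ forall l, supp A j l -> supp A i l) (below j i).
Proof.
apply: (iffP andP) => -[pij ji]; split=> //.
  by move=> l; apply/implyP/(forallP ji).
by apply/forallP=> l; apply/implyP/ji.
Qed.

Lemma below_refl : reflexive below.
Proof. by move=> i; apply/belowP; split. Qed.

Lemma below_tr : transitive below.
Proof.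
move=> j k i /belowP[pjk kj] /belowP[pij ji]; apply/belowP.
by split=> [|l /kj/ji //]; apply: p_tr pjk.
Qed.

Lemma fix_below (f : boolM n) i k :
  subrel (supp f) p -> (f * A)%g = A -> supp f i k -> below k i.
Proof.
move=> pf fA fik; apply/belowP; split=> [|l Akl]; first exact: pf.
by rewrite -fA; apply: mul_supp Akl.
Qed.

(** Everything in sight contains the diagonal, so that products only enlarge
their factors.  The matrix e of below is idempotent by transitivity, and
contains every f that fixes A, whence e <= f e <= e e = e. *)
Lemma left_fixer_unit :
    reflexive (supp A) ->
  left_fixer (fun B => subrel (supp B) p /\ reflexive (supp B)) A
    (mx_rel (fun i j => below j i)).
Proof.
move=> A_refl; set e := mx_rel _.
have suppe i j : supp e i j = below j i by rewrite supp_mx_rel.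
have e_refl: reflexive (supp e) by move=> i; rewrite suppe below_refl.
have ee : (e * e)%g = e.
  apply: suppP=> i j; apply/supp_mulP/idP => [[k]|eij]; last by exists i.
  by rewrite !suppe => ki jk; apply: below_tr ki.
split=> //.
- by split=> // i j; rewrite suppe => /belowP[].
- apply: suppP=> i j; apply/supp_mulP/idP => [[k]|Aij]; last by exists i.
  by rewrite suppe => /belowP[_]; apply.
move=> f [pf f_refl] fA; apply: suppP=> i j.
apply/supp_mulP/idP => [[k fik ekj]|eij]; last by exists i.
by rewrite -ee; apply: mul_supp ekj; rewrite suppe; apply: fix_below fik.
Qed.

Definition strictly_below k j := below k j && ~~ below j k.

(** Rows strictly below j may equal row j as sets, when p relates the two
indices in one direction only; row j is then reducible, so that among equal rows
only the lowest ones are kept. *)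
Definition irreducible_row j :=
  [exists l, supp A j l && [forall k, strictly_below k j ==> ~~ supp A k l]].

Lemma irreducible_rowP j :
  reflect
    (exists2 l, supp A j l & forall k, strictly_below k j -> ~~ supp A k l)
    (irreducible_row j).
Proof.
apply: (iffP existsP) => [[l /andP[Ajl /forallP no_k]] | [l Ajl no_k]].
  by exists l => // k; apply/implyP.
by exists l; rewrite Ajl; apply/forallP=> k; apply/implyP/no_k.
Qed.

(** Every row is the union of the irreducible rows below it, by descent along
the strict part of below. *)
Lemma irreducible_cover i l :
  supp A i l -> exists j, [/\ below j i, irreducible_row j & supp A j l].
Proof.
have [m] := ubnP #|[pred k | below k i]|; elim: m i => // m IHm i ltim Ail.
have [/existsP[k /andP[/andP[ki nik] Akl]] | no_k] :=
  boolP [exists k, strictly_below k i && supp A k l]; last first.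
  exists i; split=> //; first exact: below_refl.
  apply/irreducible_rowP; exists l => // k ki; apply: contra no_k => Akl.
  by apply/existsP; exists k; rewrite ki.
have [|j [jk irr_j Ajl]] := IHm k _ Akl.
  rewrite ltnS in ltim; apply: leq_trans ltim; apply: proper_card.
  apply/properP; split; last by exists i; rewrite inE ?below_refl.
  by apply/subsetP=> j; rewrite !inE => jk; apply: below_tr ki.
by exists j; split=> //; apply: below_tr ki.
Qed.

(** The point is that if e_ij = 1 and f fixes A, then f selects for i some row k
that is above the irreducible row j.  Row j has an entry l not covered from
strictly below; l also lies in row i, so f selects a row k containing l.
Suppose that j is not below k.  If i = j, then k is strictly below j and covers
l.  Otherwise i, j, k are all the indices there are; f selects neither i nor j for
i, since either would do, hence row i = row k contains row j.  Then p k j must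
fail, and this confines row k to its diagonal entry, so row j = row k and k is
strictly below j, covering l again. *)
Lemma left_fixer_small :
    n <= 3 -> total p -> subrel (supp A) p ->
  left_fixer (fun B => subrel (supp B) p) A
    (mx_rel (fun i j => below j i && irreducible_row j)).
Proof.
move=> le_n3 p_tot pA; set e := mx_rel _.
have suppe i j : supp e i j = below j i && irreducible_row j.
  by rewrite supp_mx_rel.
split.
- by move=> i j; rewrite suppe => /andP[/belowP[]].
- apply: suppP=> i j; apply/supp_mulP/idP => [[k]|].
    by rewrite !suppe => /andP[ki _] /andP[jk ->]; rewrite (below_tr jk ki).
  by rewrite suppe => /andP[ji irr]; exists j; rewrite suppe ?below_refl ?ji.
- apply: suppP=> i l; apply/supp_mulP/idP => [[k] | /irreducible_cover[j]].
    by rewrite suppe => /andP[/belowP[_ ki] _]; apply: ki.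
  by case=> ji irr Ajl; exists j => //; rewrite suppe ji.
move=> f pf fA; apply: suppP=> i j; apply/supp_mulP/idP => [[k fik] | ].
  rewrite !suppe => /andP[jk ->]; rewrite andbT.
  exact: below_tr (fix_below pf fA fik).
rewrite suppe => /andP[ji irr_j].
have witness k : supp f i k -> below j k -> exists2 k, supp f i k & supp e k j.
  by move=> fik jk; exists k => //; rewrite suppe jk.
have /irreducible_rowP[l Ajl no_l] := irr_j.
have [_ /(_ l Ajl)] := belowP _ _ ji.
rewrite -{1}fA => /supp_mulP[k fik Akl].
have ki := fix_below pf fA fik.
have [/(witness _ fik) // | njk] := boolP (below j k).
have [eqij | neqij] := eqVneq i j.
  by have:= no_l k; rewrite /strictly_below njk -eqij ki Akl => /(_ isT).
have [/witness/(_ ji) // | nfii] := boolP (supp f i i).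
have [/witness/(_ (below_refl j)) // | nfij] := boolP (supp f i j).
have neqki : k != i by apply: contraNneq njk => ->.
have neqkj : k != j by apply: contraNneq njk => ->; apply: below_refl.
have all_ijk m : [|| m == i, m == j | m == k].
  apply: contraLR le_n3; rewrite !negb_or -ltnNge => /and3P[mi mj mk].
  have/card_uniqP/= <- : uniq [:: m; i; j; k].
    by rewrite /= !inE !negb_or mi mj mk neqij eq_sym neqki eq_sym neqkj.
  by rewrite -[X in _ <= X]card_ord max_card.
have ik l' : supp A i l' -> supp A k l'.
  rewrite -{1}fA => /supp_mulP[m fim Aml'].
  have:= all_ijk m; case: eqP fim nfii => [-> -> // | _ fim _].
  by case: eqP fim nfij => [-> -> // | _ _ _ /eqP <-].
have [pij jsubi] := belowP _ _ ji.
have npkj : ~~ p k j.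
  apply: contra njk => pkj; apply/belowP; split=> // m /jsubi; exact: ik.
have pjk : p j k by have:= p_tot k j; rewrite (negPf npkj).
have only_k m : supp A k m -> m = k.
  move/pA => pkm; have:= all_ijk m.
  case: eqP => [eq_m | _]; first by rewrite (p_tr pkm) ?eq_m in npkj.
  by case: eqP => [eq_m | _ /eqP //]; rewrite -eq_m pkm in npkj.
have kj : below k j.
  apply/belowP; split=> // m /only_k->.
  by rewrite -(only_k l Akl).
by have:= no_l k; rewrite /strictly_below njk kj Akl => /(_ isT).
Qed.

End Rows.

(** * Two configurations without suitable idempotents *)

(** Products of these matrices are computed on lists of pairs, whatever the
value of n. *)
Definition edges n (s : seq (nat * nat)) : boolM n :=
  mx_rel (fun i j => (val i, val j) \in s).

Definition comp (s t : seq (nat * nat)) : seq (nat * nat) :=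
  [seq (x.1, y.2) | x <- s, y <- [seq y <- t | y.1 == x.2]].

Definition uni_edges n (s : seq (nat * nat)) : boolM n :=
  (1%:M + edges n s)%R.

Section Edges.
Variable n : nat.
Implicit Types s t : seq (nat * nat).

Lemma supp_edges s (i j : 'I_n) : supp (edges n s) i j = ((val i, val j) \in s).
Proof. by rewrite supp_mx_rel. Qed.

Lemma eq_edges s t : all [in t] s -> all [in s] t -> edges n s = edges n t.
Proof.
move=> /allP st /allP ts; apply: suppP=> i j; rewrite !supp_edges.
by apply/idP/idP => [/st | /ts].
Qed.

Lemma mul_edges m s t :
  m <= n -> all (fun x => x.2 < m) s ->
  (edges n s * edges n t)%g = edges n (comp s t).
Proof.
move=> le_mn /allP ltsm; apply: suppP=> i j; rewrite supp_edges.
apply/supp_mulP/allpairsPdep => [[k] | [[i' k] [[k' j'] [/= sik]]]].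
  rewrite !supp_edges => sik tkj.
  by exists (val i, val k), (val k, val j); rewrite mem_filter /= eqxx.
rewrite mem_filter => /andP[/= /eqP ->] tkj [iE jE].
exists (Ordinal (leq_trans (ltsm _ sik) le_mn));
  by rewrite supp_edges /= ?iE ?jE.
Qed.

Lemma supp_uni_edges s (i j : 'I_n) :
  supp (uni_edges n s) i j = (i == j) || ((val i, val j) \in s).
Proof. by rewrite supp_add supp_edges -boolM_oneE supp_one. Qed.

Lemma mul_uni_edges m s t :
  m <= n -> all (fun x => x.2 < m) s ->
  (uni_edges n s * uni_edges n t)%g = uni_edges n (s ++ t ++ comp s t).
Proof.
move=> le_mn ltsm; rewrite boolM_mulE mulmxDl mul1mx mulmxDr mulmx1 -boolM_mulE.
rewrite (mul_edges _ le_mn ltsm); apply: suppP=> i j.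
rewrite supp_uni_edges !mem_cat !supp_add !supp_edges -boolM_oneE supp_one.
by rewrite -!orbA; congr (_ || _); rewrite orbCA.
Qed.

Lemma edges_upper s :
  all (fun x => x.1 <= x.2) s -> subrel (supp (edges n s)) (fun i j => i <= j).
Proof. by move/allP=> le_s i j; rewrite supp_edges => /le_s. Qed.

Lemma uni_edges_unitrig s :
  all (fun x => x.1 <= x.2) s -> upper_unitrig (uni_edges n s).
Proof.
move/allP=> le_s; apply/upper_unitrig_supp; split=> [i j | i].
  by rewrite supp_uni_edges => /orP[/eqP->|/le_s].
by rewrite supp_uni_edges eqxx.
Qed.

(* Numbering from 0: A3 gives the rows {0,1}, {1,2}, {2}, then singletons; x3
   adds row 2 to row 0, and y3 adds row 1 to row 0.  The diagonal is implicit. *)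
Let A3 : seq (nat * nat) := [:: (0, 1); (1, 2)].
Let x3 : seq (nat * nat) := [:: (0, 2)].
Let y3 : seq (nat * nat) := [:: (0, 1)].

(** A fixer e of A uses row k for row i only if row k is contained in row i.  So
e_11 = 1, as row 1 contains no other row with an entry in column 1, while
e_01 = e_21 = 0.  The entry (0, 1) then separates the two products. *)
Lemma fixer_separates_rows (e : boolM n) : 3 <= n ->
    (e * uni_edges n A3 = uni_edges n A3)%g ->
  (uni_edges n x3 * e)%g <> (uni_edges n y3 * e)%g.
Proof.
move=> n3; set A := uni_edges n A3 => eA xe_ye.
pose i0 := Ordinal (ltnW (ltnW n3) : 0 < n).
pose i1 := Ordinal (ltnW n3 : 1 < n).
pose i2 := Ordinal (n3 : 2 < n).
have Aentry i k j : supp A k j -> supp e i k -> supp A i j.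
  by rewrite -{2}eA => Akj eik; apply: mul_supp Akj.
have e11 : supp e i1 i1.
  (* Only rows 0 and 1 of A have an entry in column 1. *)
  have: supp A i1 i1 by rewrite supp_uni_edges.
  rewrite -{1}eA => /supp_mulP[k e1k]; rewrite supp_uni_edges.
  case: eqVneq e1k => [-> // | _ e1k].
  rewrite !inE !xpair_eqE andbT andbF orbF => /eqP k0.
  have eqk : k = i0 by apply: val_inj; rewrite /= k0.
  have := Aentry _ k i0 _ e1k.
  by rewrite eqk !supp_uni_edges eqxx /= => /(_ isT).
have: supp (uni_edges n y3 * e)%g i0 i1.
  by apply: mul_supp e11; rewrite supp_uni_edges.
rewrite -xe_ye => /supp_mulP[k]; rewrite supp_uni_edges.
case: eqVneq => [<- _ e01 | _].
  by have := Aentry _ _ i2 _ e01; rewrite !supp_uni_edges => /(_ isT).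
rewrite !inE => /= /eqP[k2] e21.
have eqk : k = i2 by apply: val_inj.
rewrite eqk in e21.
by have := Aentry _ _ i1 _ e21; rewrite !supp_uni_edges eqxx => /(_ isT).
Qed.

(* A4 gives the rows {1,2,3}, {1,2}, {2,3}, {3}; f4 and g4 express row 0 as the
   union of rows 1 and 2, and of rows 1 and 3. *)
Let A4 : seq (nat * nat) :=
  [:: (0, 1); (0, 2); (0, 3); (1, 1); (1, 2); (2, 2); (2, 3); (3, 3)].
Let f4 : seq (nat * nat) := [:: (0, 1); (0, 2); (1, 1); (2, 2); (3, 3)].
Let g4 : seq (nat * nat) := [:: (0, 1); (0, 3); (1, 1); (2, 2); (3, 3)].

(** A fixer e of A must use row 2 for itself, as rows 0 and 1, the other ones
with an entry in column 2, are not contained in it.  Then f e = e forces e_02 =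
1, and g e = e makes row 1 or row 3 use row 2, which neither contains. *)
Lemma no_common_fixer (e : boolM n) : 4 <= n ->
  (edges n f4 * e = e)%g -> (edges n g4 * e = e)%g ->
  (e * edges n A4)%g <> edges n A4.
Proof.
move=> n4 fe ge eA.
pose i0 := Ordinal (ltnW (ltnW (ltnW n4)) : 0 < n).
pose i1 := Ordinal (ltnW (ltnW n4) : 1 < n).
pose i2 := Ordinal (ltnW n4 : 2 < n).
pose i3 := Ordinal (n4 : 3 < n).
have Aentry i k j :
    supp (edges n A4) k j -> supp e i k -> supp (edges n A4) i j.
  by rewrite -{2}eA => Akj eik; apply: mul_supp Akj.
have e22 : supp e i2 i2.
  have: supp (edges n A4) i2 i2 by rewrite supp_edges.
  rewrite -{1}eA => /supp_mulP[k e2k]; have := Aentry _ _ i1 _ e2k.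
  rewrite !supp_edges /= !inE !xpair_eqE /= !andbT !andbF /=.
  case: eqP => [-> /(_ isT) // | _ /=].
  case: eqP => [-> /(_ isT) // | _ /=] _; rewrite orbF => /eqP k2.
  by rewrite -{2}(_ : k = i2) //; apply: val_inj.
have e02 : supp e i0 i2.
  by rewrite -fe; apply: mul_supp e22; rewrite supp_edges.
move: e02; rewrite -ge => /supp_mulP[k]; rewrite supp_edges !inE !xpair_eqE /=.
rewrite orbF => /orP[] /eqP kE ek2.
  have eqk : k = i1 by apply: val_inj.
  by have := Aentry _ _ i3 _ ek2; rewrite eqk !supp_edges => /(_ isT).
have eqk : k = i3 by apply: val_inj.
by have := Aentry _ _ i2 _ ek2; rewrite eqk !supp_edges => /(_ isT).
Qed.

Lemma upper_not_Fountain (S : boolM n -> Prop) (T : monoidType) v :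
    4 <= n -> @represents n S T v ->
    (forall A, subrel (supp A) (fun i j => i <= j) -> S A) ->
  ~ Fountain T.
Proof.
move=> n4 repT upS.
apply: (not_Fountain_repr (A := edges n A4) (f := edges n f4) (g := edges n g4)
          repT).
- by split; apply/upS/edges_upper.
- by split; rewrite (mul_edges _ n4) //; apply: eq_edges.
by move=> e; apply: no_common_fixer.
Qed.

Lemma unitri_not_abundant (S : boolM n -> Prop) (T : monoidType) v :
    3 <= n -> @represents n S T v -> (forall A, upper_unitrig A -> S A) ->
  ~ abundant T.
Proof.
move=> n3 repT upS.
apply: (not_abundant_repr (A := uni_edges n [:: (0, 1); (1, 2)])
          (x := uni_edges n [:: (0, 2)]) (y := uni_edges n [:: (0, 1)]) repT).
- by split; apply/upS/uni_edges_unitrig.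
- rewrite !(mul_uni_edges _ n3) //; congr (_ + _)%R; exact: eq_edges.
by move=> e; apply: fixer_separates_rows.
Qed.

End Edges.

(** * The Fountain property *)

Lemma represents_M n :
  represents (fun A => subrel (supp A) (fun _ _ => true))
    (id : boolM n -> boolM n).
Proof. by split=> // A _; exists A. Qed.

Lemma represents_UT n :
  represents (fun A => subrel (supp A) (fun i j => i <= j)) (@boolUT_val n).
Proof.
split=> // [|[A uA]|A /upper_trig_supp uA]; first exact: val_inj.
  exact/upper_trig_supp.
by exists (BoolUT uA).
Qed.

Lemma represents_U n :
  represents
    (fun A => subrel (supp A) (fun i j => i <= j) /\ reflexive (supp A))
    (@boolU_val n).
Proof.
split=> // [|[A uA]|A /upper_unitrig_supp uA]; first exact: val_inj.
  exact/upper_unitrig_supp.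
by exists (BoolU uA).
Qed.

Lemma Fountain_U n : Fountain (boolU n).
Proof.
apply: (Fountain_fixers (represents_U n)) => A [_ A_refl].
  eexists; apply: (@left_fixer_unit n (fun i j => i <= j)) => //.
  by move=> j i k; apply: leq_trans.
eexists.
apply: (@left_fixer_tr _ _
  (fun B => subrel (supp B) (fun i j => j <= i) /\ reflexive (supp B))).
  move=> B; split=> -[uB B_refl]; split=> [i j|i].
  - by rewrite supp_tr => /uB.
  - by rewrite supp_tr.
  - by rewrite -supp_tr => /uB.
  by rewrite -supp_tr.
apply: (@left_fixer_unit n (fun i j => j <= i)) => [i|j i k ji kj|i] //.
  exact: leq_trans kj ji.
by rewrite supp_tr.
Qed.

Lemma Fountain_small n (p : rel 'I_n) (T : monoidType) v :
    n <= 3 -> transitive p -> total p ->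
  represents (T := T) (fun A => subrel (supp A) p) v -> Fountain T.
Proof.
move=> n3 p_tr p_tot repT.
have p_refl : reflexive p by move=> i; have:= p_tot i i; rewrite orbb.
apply: (Fountain_fixers repT) => A pA.
  by eexists; apply: left_fixer_small.
eexists.
apply: (@left_fixer_tr _ _ (fun B => subrel (supp B) (fun i j => p j i))).
  by move=> B; split=> pB i j; [rewrite supp_tr | rewrite -supp_tr] => /pB.
apply: left_fixer_small => // [j i k ji kj | i j]; first exact: p_tr kj ji.
by rewrite supp_tr => /pA.
Qed.

(** * Dimensions one and two *)

Lemma band_regular (T : monoidType) : band T -> regular T.
Proof. by move=> bT a; exists 1%g; rewrite mulg1 bT. Qed.

Lemma represents_band n S (T : monoidType) v :
  @represents n S T v -> band (boolM n) -> band T.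
Proof. by case=> vM v_inj _ _ bM a; apply: v_inj; rewrite vM; apply: bM. Qed.

Lemma band_M1 : band (boolM 1).
Proof.
move=> A; apply: suppP=> i j; rewrite !ord1.
apply/supp_mulP/idP => [[k]|A00]; last by exists 0%R.
by rewrite ord1.
Qed.

Lemma group_U1 : is_group (boolU 1).
Proof.
move=> a; suff ->: a = 1%g by exists 1%g; rewrite mulg1.
apply: val_inj; apply: suppP=> i j; rewrite supp_one !ord1 eqxx.
by have /upper_unitrig_supp[_ ->] := valP a.
Qed.

Section Dimension2.

Lemma supp_mul2 (A B : boolM 2) i j :
  supp (A * B)%g i j =
    (supp A i 0%R && supp B 0%R j) || (supp A i 1%R && supp B 1%R j).
Proof.
apply/supp_mulP/idP => [[k Aik Bkj] | ].
  have /orP[] : (k == 0%R) || (k == 1%R) by case: k {Aik Bkj} => [[|[]]].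
    by move/eqP<-; rewrite Aik Bkj.
  by move/eqP<-; rewrite Aik Bkj orbT.
by case/orP => /andP[]; [exists 0%R | exists 1%R].
Qed.

Lemma suppP2 (A B : boolM 2) :
    [/\ supp A 0%R 0%R = supp B 0%R 0%R, supp A 0%R 1%R = supp B 0%R 1%R,
        supp A 1%R 0%R = supp B 1%R 0%R & supp A 1%R 1%R = supp B 1%R 1%R] ->
  A = B.
Proof.
case=> e00 e01 e10 e11; apply: suppP.
have ord2 (k : 'I_2) : k = 0%R \/ k = 1%R.
  by case: k => [[|[]]] // ltk; [left | right]; apply: val_inj.
by move=> i j; case: (ord2 i) => ->; case: (ord2 j) => ->.
Qed.

(** A 2 x 2 matrix A, or else A w for the swap w of the two columns, is
idempotent; in the latter case A w A w = A w gives A w A = A. *)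
Lemma regular_M2 : regular (boolM 2).
Proof.
move=> A; pose w : boolM 2 := mx_rel (fun i j => i != j).
have ww : (w * w)%g = 1%g.
  by apply: suppP2; rewrite !supp_mul2 !supp_mx_rel !supp_one.
have [AA | wA] : idem A \/ idem (A * w)%g.
- rewrite /idem; case A00: (supp A 0%R 0%R); case A01: (supp A 0%R 1%R);
  case A10: (supp A 1%R 0%R); case A11: (supp A 1%R 1%R);
  by [ left; apply: suppP2; rewrite !supp_mul2 !(A00, A01, A10, A11)
     | right; apply: suppP2;
       rewrite !supp_mul2 !supp_mx_rel !(A00, A01, A10, A11)].
- by exists 1%g; rewrite mulg1.
exists w; transitivity (A * w * (A * w) * w)%g.
  by rewrite -!mulgA ww mulg1.
by rewrite wA -mulgA ww mulg1.
Qed.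

Lemma band_U2 : band (boolU 2).
Proof.
case=> A uA; apply: val_inj => /=.
have [up refl_A] := (upper_unitrig_supp A).1 uA.
apply: suppP2; rewrite !supp_mul2 !refl_A /= !andbT.
by split=> //; rewrite ?orbT ?orbb //; case: (supp A 1%R 0%R); rewrite ?andbF.
Qed.

Lemma upper_idem2 (A : boolM 2) :
  upper_trig A -> idem A \/ A = edges 2 [:: (0, 1)].
Proof.
move/upper_trig_supp => uA.
have A10 : supp A 1%R 0%R = false by apply: contraFF (uA 1%R 0%R) _.
case A00: (supp A 0%R 0%R); case A01: (supp A 0%R 1%R);
  case A11: (supp A 1%R 1%R);
  by [ left; apply: suppP2; rewrite !supp_mul2 !(A00, A01, A10, A11)
     | right; apply: suppP2; rewrite !supp_edges !(A00, A01, A10, A11)].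
Qed.

End Dimension2.

Lemma monoid_no_adjoined (T : monoidType) : ~ in_T1 (None : option T).
Proof. by case; exists 1%g => x; rewrite mul1g mulg1. Qed.

Lemma Rstar_monoid (T : monoidType) (a b : T) :
  (forall x y, x * a = y * a <-> x * b = y * b)%g -> Rstar a b.
Proof.
move=> ab [x|] [y|] Tx Ty //; first exact: ab.
  by case: (monoid_no_adjoined Ty).
by case: (monoid_no_adjoined Tx).
Qed.

Lemma Lstar_monoid (T : monoidType) (a b : T) :
  (forall x y, a * x = a * y <-> b * x = b * y)%g -> Lstar a b.
Proof.
move=> ab [x|] [y|] Tx Ty //; first exact: ab.
  by case: (monoid_no_adjoined Ty).
by case: (monoid_no_adjoined Tx).
Qed.

(* The single edge (k, l) is the matrix unit with its 1 in position (k, l):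
   multiplying by it keeps one column, or one row, of the other factor. *)
Section MatrixUnits.
Variable n : nat.
Implicit Types (i j k l : 'I_n) (X Y : boolM n).

Lemma mul_edge_r X k l i j :
  supp (X * edges n [:: (val k, val l)])%g i j = supp X i k && (j == l).
Proof.
apply/supp_mulP/andP => [[m Xim] | [Xik /eqP->]].
  rewrite supp_edges inE xpair_eqE => /andP[/eqP/val_inj eqm /eqP/val_inj->].
  by rewrite -eqm Xim.
by exists k; rewrite ?supp_edges ?mem_head.
Qed.

Lemma mul_edge_l X k l i j :
  supp (edges n [:: (val k, val l)] * X)%g i j = (i == k) && supp X l j.
Proof.
apply/supp_mulP/andP => [[m] | [/eqP-> Xlj]].
  rewrite supp_edges inE xpair_eqE => /andP[/eqP/val_inj-> /eqP/val_inj->].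
  by rewrite eqxx.
by exists l; rewrite ?supp_edges ?mem_head.
Qed.

Lemma eq_mul_edge_r X Y k l :
  (X * edges n [:: (val k, val l)] = Y * edges n [:: (val k, val l)])%g <->
  forall i, supp X i k = supp Y i k.
Proof.
split=> [eqXY i | eqXY]; last by apply: suppP=> i j; rewrite !mul_edge_r eqXY.
by have:= congr1 (fun Z => supp Z i l) eqXY; rewrite !mul_edge_r eqxx !andbT.
Qed.

Lemma eq_mul_edge_l X Y k l :
  (edges n [:: (val k, val l)] * X = edges n [:: (val k, val l)] * Y)%g <->
  forall j, supp X l j = supp Y l j.
Proof.
split=> [eqXY j | eqXY]; last by apply: suppP=> i j; rewrite !mul_edge_l eqXY.
by have:= congr1 (fun Z => supp Z k j) eqXY; rewrite !mul_edge_l eqxx.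
Qed.

End MatrixUnits.

Lemma UT_edges n (s : seq (nat * nat)) : all (fun x => x.1 <= x.2) s ->
  exists a : boolUT n, boolUT_val a = edges n s.
Proof. by move/(@edges_upper n)/upper_trig_supp=> us; exists (BoolUT us). Qed.

Lemma UT_eq_mul_edge_r n (k l : 'I_n) (a x y : boolUT n) :
    boolUT_val a = edges n [:: (val k, val l)] ->
  (x * a = y * a)%g <-> forall i, supp x i k = supp y i k.
Proof.
move=> aE; apply: iff_trans (eq_mul_edge_r x y k l); rewrite -aE.
by split=> [/(congr1 (@boolUT_val n)) // | eq_xy]; apply: val_inj.
Qed.

Lemma UT_eq_mul_edge_l n (k l : 'I_n) (a x y : boolUT n) :
    boolUT_val a = edges n [:: (val k, val l)] ->
  (a * x = a * y)%g <-> forall j, supp x l j = supp y l j.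
Proof.
move=> aE; apply: iff_trans (eq_mul_edge_l x y k l); rewrite -aE.
by split=> [/(congr1 (@boolUT_val n)) // | eq_xy]; apply: val_inj.
Qed.

(** Multiplying a matrix unit on the left (right) reads only its row (column)
index, so E_01 is R-star related to E_00 and L-star related to E_11. *)
Lemma abundant_UT2 : abundant (boolUT 2).
Proof.
have [e0 e0E] := @UT_edges 2 [:: (0, 0)] isT.
have [e1 e1E] := @UT_edges 2 [:: (1, 1)] isT.
have idem_edge k (e : boolUT 2) :
    k < 2 -> boolUT_val e = edges 2 [:: (k, k)] -> idem e.
  move=> ltk eE; apply: val_inj => /=.
  rewrite -[LHS]/(boolUT_val e * boolUT_val e)%g eE; apply: suppP=> i j.
  rewrite (mul_edge_r _ (Ordinal ltk) (Ordinal ltk)).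
  by rewrite !supp_edges !inE !xpair_eqE eqxx andbT.
split=> a.
  have [aa | aE] := upper_idem2 (valP a).
    by exists a; split=> //; apply: val_inj.
  exists e0; split; first exact: idem_edge e0E.
  apply: Rstar_monoid => x y; apply: iff_trans (iff_sym _).
    exact: (@UT_eq_mul_edge_r 2 0%R 1%R).
  exact: (@UT_eq_mul_edge_r 2 0%R 0%R).
have [aa | aE] := upper_idem2 (valP a).
  by exists a; split=> //; apply: val_inj.
exists e1; split; first exact: idem_edge e1E.
apply: Lstar_monoid => x y; apply: iff_trans (iff_sym _).
  exact: (@UT_eq_mul_edge_l 2 0%R 1%R).
exact: (@UT_eq_mul_edge_l 2 1%R 1%R).
Qed.

Lemma not_regular_UT2 : ~ regular (boolUT 2).
Proof.
have [a aE] := @UT_edges 2 [:: (0, 1)] isT => /(_ a)[x].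
have /upper_trig_supp ux := valP x.
move/(congr1 (@boolUT_val 2)).
rewrite -[LHS]/(boolUT_val a * val x * boolUT_val a)%g.
rewrite aE => /(congr1 (fun Z => supp Z 0%R 1%R)).
rewrite (mul_edge_r _ 0%R 1%R) (mul_edge_l _ 0%R 1%R) supp_edges eqxx andbT /=.
by move/ux.
Qed.

Theorem theorem5p2 :
  [/\ regular (boolM 1) /\ band (boolM 1),
      regular (boolM 2),
      Fountain (boolM 3) /\ ~ abundant (boolM 3)
    & forall n : nat, 4 <= n -> ~ Fountain (boolM n)]
  /\
  [/\ regular (boolUT 1) /\ band (boolUT 1),
      abundant (boolUT 2) /\ ~ regular (boolUT 2),
      Fountain (boolUT 3) /\ ~ abundant (boolUT 3)
    & forall n : nat, 4 <= n -> ~ Fountain (boolUT n)]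
  /\
  [/\ regular (boolU 1) /\ is_group (boolU 1),
      regular (boolU 2) /\ band (boolU 2)
    & forall n : nat, 3 <= n -> Fountain (boolU n) /\ ~ abundant (boolU n)].
Proof.
split; last split.
- split.
  + by split; [apply: band_regular|]; apply: band_M1.
  + exact: regular_M2.
  + split; last exact: unitri_not_abundant (leqnn 3) (represents_M 3) _.
    exact: Fountain_small (represents_M 3).
  by move=> n n4; apply: upper_not_Fountain n4 (represents_M n) _.
- have UT1 := represents_band (represents_UT 1) band_M1; split.
  + by split=> //; apply: band_regular.
  + by split; [apply: abundant_UT2 | apply: not_regular_UT2].
  + split.
      apply: Fountain_small (represents_UT 3) => //.
      by move=> j i k; apply: leq_trans.
    apply: (unitri_not_abundant (leqnn 3) (represents_UT 3)) => A.
    by case/(upper_unitrig_supp A).1.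
  by move=> n n4; apply: upper_not_Fountain n4 (represents_UT n) _.
have U1 := represents_band (represents_U 1) band_M1; split.
- by split; [apply: band_regular | apply: group_U1].
- by split; [apply: band_regular|]; apply: band_U2.
move=> n n3; split; first exact: Fountain_U.
by apply: unitri_not_abundant n3 (represents_U n) _ => A /upper_unitrig_supp.
Qed.
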